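(* Let $G$ be any graph on $n$ vertices with exactly $h$ universal vertices ($h \ge 0$). Let $k$ be an integer with $k \in [n/2, n]$. If there exists a positive integer $\alpha$ such that $$d_k(G) > \frac{1}{2k + 1 - n} \cdot \left(n^2 \cdot \binom{n - \alpha - 1}{k} + \alpha \cdot \binom{n - h}{k}\right),$$ then the sequence $d_k(G), d_{k+1}(G), \ldots, d_n(G)$ is decreasing, so the mode of the domination polynomial of $G$ is at most $k$.
   Context: All graphs are finite, undirected and simple. For a graph $G=(V,E)$ on $n$ vertices and $S \subseteq V$, the (closed) neighborhood $N(S)$ is the set of vertices that are either in $S$ or adjacent to a vertex of $S$. A set $S$ is dominating if $N(S)=V$. Let $d_i(G)$ be the number of $i$-element dominating vertex sets of $G$ (with $d_{n+1}(G)=0$); the domination polynomial is $D(G,x)=\sum_{i=1}^n d_i(G)x^i$. A vertex $v$ is universal if it is adjacent to every other vertex. Binomial coefficients $\binom{m}{k}$ are $0$ when $k>m$ (and when $m<0$). A polynomial $f(x)=\sum_{i=0}^n a_i x^i$ is unimodal if there is $k\in[0,n]$ with $a_i \le a_{i+1}$ for all $i<k$ and $a_i \ge a_{i+1}$ for all $i \ge k$; the largest such $k$ is called the mode of $f$. *)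

(* Defs.v *)
From mathcomp Require Import all_boot all_order all_algebra.

Set Implicit Arguments.
Unset Strict Implicit.
Unset Printing Implicit Defensive.

Import Order.TTheory GRing.Theory Num.Theory.
Local Open Scope ring_scope.

(* A finite simple graph is a finType T of vertices with an adjacency relation
   e : rel T; symmetry and irreflexivity of e are hypotheses of the theorem. *)

Definition closed_nbhd (T : finType) (e : rel T) (S : {set T}) : {set T} :=
  [set v | (v \in S) || [exists u in S, e u v]].

Definition dominating (T : finType) (e : rel T) (S : {set T}) : bool :=
  closed_nbhd e S == [set: T].

Definition num_dom (T : finType) (e : rel T) (i : nat) : nat :=
  #|[set S : {set T} | (#|S| == i) && dominating e S]|.

Definition dom_poly (T : finType) (e : rel T) : {poly int} :=
  \sum_(1 <= i < #|T|.+1) (num_dom e i)%:R *: 'X^i.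

Definition universal (T : finType) (e : rel T) (v : T) : bool :=
  [forall u, (u != v) ==> e v u].

(* Binomial coefficient with an integer upper index, equal to 0 when that index
   is negative (truncated subtraction on nat would give 'C(0, k) instead). *)
Definition binz (m : int) (k : nat) : nat :=
  if m is Posz m' then 'C(m', k) else 0%N.

(* The coefficients of p increase weakly up to index m and decrease weakly from
   m on; coefficients beyond the degree (size p).-1 are 0. *)
Definition peak_at (R : numDomainType) (p : {poly R}) (m : nat) : Prop :=
  [/\ (m <= (size p).-1)%N,
      forall i, (i < m)%N -> p`_i <= p`_i.+1 &
      forall i, (m <= i)%N -> p`_i.+1 <= p`_i].

Definition unimodal (R : numDomainType) (p : {poly R}) : Prop :=
  exists m, peak_at p m.

(* The mode is the largest peak index; it exists exactly when p is unimodal. *)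
Definition is_mode (R : numDomainType) (p : {poly R}) (m : nat) : Prop :=
  peak_at p m /\ forall m', peak_at p m' -> (m' <= m)%N.

(* Main.v *)
(** Every superset of a dominating set is dominating, so counting the pairs
    (S, v) with #|S| = i, v outside S and v |: S dominating gives
    (i+1) d_{i+1} = (n-i) d_i + A_i, where A_i counts the pairs in which S is
    not dominating.  Such an S contains no universal vertex; if moreover S misses
    the closed neighborhood of w, then every v completing S lies in that
    neighborhood.  Hence either S has at most alpha completions, or S avoids a
    closed neighborhood with more than alpha vertices, and therefore
    A_i <= B_i := n^2 C(n-alpha-1, i) + alpha C(n-h, i).
    If B_i < (2i+1-n) d_i then (i+1) d_{i+1} < (i+1) d_i.  This inequality
    propagates from i to i+1 because d_{i+1} >= (n-i)/(i+1) d_i while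
    B_{i+1} <= (n-i)/(i+1) B_i. *)

Require Import Defs.
From mathcomp Require Import all_boot all_order all_algebra.
From mathcomp Require Import zify lra.

Set Implicit Arguments.
Unset Strict Implicit.
Unset Printing Implicit Defensive.

Import Order.TTheory GRing.Theory Num.Theory.
Local Open Scope ring_scope.

(** Absorption: $(i+1)\binom{m}{i+1} = (m-i)\binom{m}{i}$, and $m \le n$. For negative [m] both
    sides vanish. *)
Lemma binz_mulS_le (m : int) (n i : nat) :
  m <= n%:Z -> (i.+1 * binz m i.+1 <= (n - i) * binz m i)%N.
Proof.
case: m => [m|m] le_mn /=; last by rewrite !muln0.
by rewrite mul_bin_left leq_mul2r leq_sub2r ?orbT.
Qed.

Lemma leq_bin_binz (m i : nat) (z : int) :
  m%:Z <= z -> ('C(m, i) <= binz z i)%N.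
Proof.
by case: z => [z|z] le_mz; [apply: leq_bin2l; lia | lia].
Qed.

Section Domination.
Variables (T : finType) (e : rel T).
Implicit Types (S U : {set T}) (v w : T) (i a : nat).

Definition dom_ext S : {set T} :=
  [set v | (v \notin S) && dominating e (v |: S)].

(** Edges point towards [w], as in [closed_nbhd]: these are the vertices that can cover [w]. *)
Definition in_nbhd w : {set T} := [set u | (u == w) || e u w].

Lemma mem_closed_nbhd S w :
  (w \in closed_nbhd e S) = ~~ (S \subset ~: in_nbhd w).
Proof.
rewrite inE; apply/idP/subsetPn.
  case/orP=> [wS|/existsP[u /andP[uS euw]]].
    by exists w; rewrite // !inE eqxx.
  by exists u; rewrite // !inE euw orbT.
case=> u uS; rewrite !inE negbK => /orP[/eqP<-|euw]; first by rewrite uS.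
by apply/orP; right; apply/existsP; exists u; rewrite uS.
Qed.

Lemma dominatingPn S :
  reflect (exists w, S \subset ~: in_nbhd w) (~~ dominating e S).
Proof.
rewrite /dominating eqEsubset subsetT /=.
apply: (iffP subsetPn) => [[w _]|[w Sw]].
  by rewrite mem_closed_nbhd negbK; exists w.
by exists w; rewrite ?in_setT // mem_closed_nbhd Sw.
Qed.

Lemma dominating_sub S U : S \subset U -> dominating e S -> dominating e U.
Proof.
move=> sSU; apply: contraLR => /dominatingPn[w Uw].
by apply/dominatingPn; exists w; apply: subset_trans Uw.
Qed.

Lemma num_domS_sum i :
  (i.+1 * num_dom e i.+1 = \sum_(S : {set T} | #|S| == i) #|dom_ext S|)%N.
Proof.
rewrite /num_dom mulnC -sum_nat_const.
under eq_bigr => U do [rewrite inE => /andP[/eqP <- _]; rewrite -sum1_card].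
under [RHS]eq_bigr => S _ do rewrite -sum1_card.
rewrite (exchange_big_dep xpredT) //= [RHS](exchange_big_dep xpredT) //=.
apply: eq_bigr => v _.
(* For fixed [v], adding and removing [v] are inverse bijections; the condition [(v |: S) :\ v == S]
   left by the reindexing says that [v] lies outside [S]. *)
rewrite (reindex_onto (fun S => v |: S) (fun U => U :\ v)) /=; last first.
  by move=> U /andP[_ vU]; rewrite setD1K.
apply: eq_bigl => S; rewrite !inE eqxx /= andbT cardsU1.
have -> : ((v |: S) :\ v == S) = (v \notin S).
  apply/eqP/idP => [<-|/setU1K //]; first by rewrite !inE eqxx.
by case: (v \in S); rewrite ?andbF //= andbT eqSS.
Qed.

Definition critical_count i : nat :=
  (\sum_(S : {set T} | (#|S| == i) && ~~ dominating e S) #|dom_ext S|)%N.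

Lemma num_domS i :
  (i.+1 * num_dom e i.+1 = (#|T| - i) * num_dom e i + critical_count i)%N.
Proof.
rewrite num_domS_sum (bigID (dominating e)) /=; congr addn.
rewrite mulnC /num_dom -sum_nat_const.
apply: eq_big => [S|S /andP[/eqP <- domS]]; first by rewrite inE.
rewrite -[in RHS](setCK S) -cardsCs; apply: eq_card => v.
by rewrite !inE (dominating_sub (subsetU1 v S)) ?andbT.
Qed.

Lemma dom_ext_sub_nbhd S w : S \subset ~: in_nbhd w -> dom_ext S \subset in_nbhd w.
Proof.
move=> Sw; apply/subsetP=> v; rewrite inE => /andP[_]; apply: contraLR => vw.
by apply/dominatingPn; exists w; rewrite subUset sub1set inE vw.
Qed.

(** If [S] misses [w], its completions lie in [in_nbhd w]. Either that set has at most [a] elements,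
    or the single term of [w] in the sum already pays for all of [T]. *)
Lemma card_dom_ext_le a S : ~~ dominating e S ->
  (#|dom_ext S| <= a + \sum_(w | (a < #|in_nbhd w|) && (S \subset ~: in_nbhd w)) #|T|)%N.
Proof.
case/dominatingPn=> w Sw; case: (ltnP a #|in_nbhd w|) => aw.
  by rewrite (bigD1 w) /= ?aw ?Sw // addnCA (leq_trans (max_card _)) ?leq_addr.
apply: leq_trans (leq_addr _ _); apply: leq_trans aw.
exact/subset_leq_card/dom_ext_sub_nbhd.
Qed.

Lemma dominating_universal S v : v \in S -> universal e v -> dominating e S.
Proof.
move=> vS /forallP uv; apply/negPn/dominatingPn => -[w /subsetP/(_ v vS)].
rewrite !inE; have [->|nvw] := eqVneq v w; first by [].
by have := uv w; rewrite eq_sym nvw /= => ->.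
Qed.

Lemma card_nondominating_le i :
  (#|[set S : {set T} | (#|S| == i) && ~~ dominating e S]|
     <= 'C(#|T| - #|[set v | universal e v]|, i))%N.
Proof.
rewrite -[[set v | _]]setCK -cardsCs -cards_draws.
apply/subset_leq_card/subsetP => S; rewrite !inE => /andP[-> ndS].
rewrite andbT; apply/subsetP => v vS; rewrite !inE.
by apply: contra ndS; apply: dominating_universal.
Qed.

(** After the sums are exchanged, each [w] with a large neighborhood costs $n$ for every [i]-subset
    of its complement, which has at most $n-a-1$ vertices. The $n$ choices of [w] give the factor
    $n^2$. *)
Lemma critical_count_le a i :
  (critical_count i <= #|T| ^ 2 * binz (#|T|%:Z - a%:Z - 1) i
     + a * 'C(#|T| - #|[set v | universal e v]|, i))%N.
Proof.
pose P S := (#|S| == i) && ~~ dominating e S.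
pose far S w := (a < #|in_nbhd w|)%N && (S \subset ~: in_nbhd w).
have le1 : (critical_count i <= \sum_(S | P S) (a + \sum_(w | far S w) #|T|))%N.
  by apply: leq_sum => S /andP[_]; apply: card_dom_ext_le.
apply: leq_trans le1 _; rewrite big_split /= addnC; apply: leq_add; last first.
  rewrite -(eq_bigl _ _ (in_set P)) sum_nat_const mulnC leq_mul2l.
  by rewrite card_nondominating_le orbT.
rewrite (exchange_big_dep (fun w => a < #|in_nbhd w|)%N) /=; last by move=> S w _ /andP[].
apply: (@leq_trans (\sum_(w : T) #|T| * binz (#|T|%:Z - a%:Z - 1) i)); last first.
  by rewrite sum_nat_const mulnA mulnn.
rewrite [leqRHS](bigID (fun w => a < #|in_nbhd w|)%N) /=.
apply: leq_trans (leq_addr _ _); apply: leq_sum => w aw.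
rewrite -(eq_bigl _ _ (in_set (fun S => P S && far S w))).
rewrite sum_nat_const mulnC leq_mul2l; apply/orP; right.
apply: leq_trans (@leq_bin_binz #|~: in_nbhd w| i _ _).
  rewrite -cards_draws; apply/subset_leq_card/subsetP => S.
  by rewrite !inE => /andP[/andP[-> _] /andP[_ ->]].
by rewrite -(cardsC (in_nbhd w)); lia.
Qed.

End Domination.

Section Descent.
Variables (T : finType) (e : rel T) (a : nat).
Let n := #|T|.

Definition critical_bound (i : nat) : nat :=
  (n ^ 2 * binz (n%:Z - a%:Z - 1) i
     + a * 'C(n - #|[set v | universal e v]|, i))%N.

Lemma critical_bound_mulS i :
  (i.+1 * critical_bound i.+1 <= (n - i) * critical_bound i)%N.
Proof.
rewrite /critical_bound !mulnDr; apply: leq_add; rewrite mulnCA [leqRHS]mulnCA leq_mul2l.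
  by rewrite binz_mulS_le ?orbT; lia.
by rewrite (@binz_mulS_le (Posz _)) ?orbT //; lia.
Qed.

Lemma num_dom_decr i : (n <= i.*2)%N ->
  (critical_bound i < (i.*2.+1 - n) * num_dom e i)%N ->
  (num_dom e i.+1 < num_dom e i)%N.
Proof.
move=> le_n lt_b; rewrite -(ltn_pmul2l (ltn0Sn i)) num_domS -/n.
have := critical_count_le e a i; rewrite -/n -/(critical_bound i) => le_c.
have [le_in|lt_ni] := leqP i n.
  (* This splitting cancels the term $(n-i)d_i$ of [num_domS]. *)
  have -> : (i.+1 = (n - i) + (i.*2.+1 - n))%N by lia.
  by rewrite mulnDl ltn_add2l (leq_ltn_trans le_c).
have d0 : num_dom e i = 0%N.
  apply/eqP; rewrite cards_eq0; apply/eqP/setP => S; rewrite !inE.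
  by apply/negP => /andP[/eqP cS _]; have := max_card S; rewrite cS leqNgt lt_ni.
by rewrite d0 muln0 in lt_b.
Qed.

Lemma critical_bound_step i : (n <= i.*2)%N -> (i < n)%N ->
  (critical_bound i < (i.*2.+1 - n) * num_dom e i)%N ->
  (critical_bound i.+1 < (i.+1.*2.+1 - n) * num_dom e i.+1)%N.
Proof.
move=> le_n lt_in lt_b; rewrite -(ltn_pmul2l (ltn0Sn i)).
apply: leq_ltn_trans (critical_bound_mulS i) _.
have lt_b' : ((n - i) * critical_bound i < (n - i) * ((i.*2.+1 - n) * num_dom e i))%N.
  by rewrite ltn_pmul2l // subn_gt0.
apply: leq_trans lt_b' _.
(* The factor $2i+1-n$ only grows with [i], and dropping [critical_count] from [num_domS] leaves
   $(n-i)d_i \le (i+1)d_{i+1}$. *)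
rewrite mulnCA [leqRHS]mulnCA num_domS; apply: leq_mul; first by lia.
exact: leq_addr.
Qed.

Lemma num_dom_decr_from k : (n <= k.*2)%N ->
  (critical_bound k < (k.*2.+1 - n) * num_dom e k)%N ->
  forall i, (k <= i < n)%N -> (num_dom e i.+1 < num_dom e i)%N.
Proof.
move=> le_n lt_b i /andP[le_ki lt_in].
apply: num_dom_decr; first by lia.
elim: i le_ki lt_in => [|i IHi]; first by rewrite leqn0 => /eqP <-.
rewrite leq_eqVlt => /orP[/eqP <- //|le_ki] lt_in.
by apply: critical_bound_step; [lia | lia | apply: IHi; lia].
Qed.

End Descent.

(** The guard [0 < i] matters on the empty graph: there the empty set dominates, yet the polynomial
    has no constant term. *)
Lemma coef_dom_poly (T : finType) (e : rel T) (i : nat) :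
  (dom_poly e)`_i = (if (0 < i <= #|T|)%N then num_dom e i else 0%N)%:R.
Proof.
rewrite /dom_poly coef_sum.
under eq_bigr => j _ do rewrite coefZ coefXn.
case: ifP => [i_in|/negbT i_out]; last first.
  rewrite big_nat big1 // => j j_in; case: eqP => [eq_ij|_]; last by rewrite mulr0.
  by case/negP: i_out; rewrite eq_ij.
rewrite (bigD1_seq i) ?mem_index_iota ?iota_uniq //= eqxx mulr1 big1 ?addr0 // => j.
by rewrite eq_sym => /negbTE ->; rewrite mulr0.
Qed.

Lemma size_dom_poly (T : finType) (e : rel T) : (size (dom_poly e) <= #|T|.+1)%N.
Proof.
by apply/leq_sizeP => i lt_i; rewrite coef_dom_poly (leqNgt i) lt_i andbF.
Qed.

Theorem theorem1p4 (T : finType) (e : rel T)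
    (e_sym : symmetric e) (e_irr : irreflexive e)
    (n h k : nat) (cardT : #|T| = n)
    (card_universal : #|[set v | universal e v]| = h)
    (k_ge : n%:R / 2 <= k%:R :> rat) (k_le : (k <= n)%N)
    (d_k_gt : exists2 alpha : nat, (0 < alpha)%N &
       (num_dom e k)%:R >
         1 / (2 * k%:R + 1 - n%:R) *
         (n%:R ^+ 2 * (binz (n%:Z - alpha%:Z - 1) k)%:R
          + alpha%:R * (binz (n%:Z - h%:Z) k)%:R) :> rat) :
  (forall i : nat, (k <= i < n)%N -> (num_dom e i.+1 < num_dom e i)%N)
  /\ (forall m : nat, is_mode (dom_poly e) m -> (m <= k)%N).
Proof.
case: d_k_gt => a _ d_k_gt.
have le_n : (n <= k.*2)%N.
  rewrite -(ler_nat rat) -muln2 natrM; lra.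
have le_h : (h <= n)%N by rewrite -card_universal -cardT max_card.
have lt_b : (critical_bound e a k < (k.*2.+1 - #|T|) * num_dom e k)%N.
  (* By [le_n] the truncated subtraction is exact. *)
  have den : (k.*2.+1 - n)%:R = 2 * k%:R + 1 - n%:R :> rat.
    by rewrite natrB ?leqW // -addn1 natrD -muln2 natrM mulrC.
  have den_gt0 : 0 < (k.*2.+1 - n)%:R :> rat by rewrite ltr0n subn_gt0 ltnS.
  move: d_k_gt; rewrite -den mul1r mulrC ltr_pdivrMr //.
  rewrite -natrX -!natrM -natrD (_ : n%:Z - h%:Z = (n - h)%N); last by lia.
  by rewrite ltr_nat (mulnC (num_dom e k)) /critical_bound /= card_universal cardT.
have decr := num_dom_decr_from (etrans (congr1 (leq^~ _) cardT) le_n) lt_b.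
rewrite cardT in decr; split=> // m [[le_m incr _] _].
have le_mn : (m <= n)%N.
  apply: leq_trans le_m _; rewrite -subn1 leq_subLR -cardT.
  exact: size_dom_poly.
(* A peak beyond [k] would force $d_k \le d_{k+1}$, against the strict descent at [k]. Here [k] is
   positive, since $k < m \le n \le 2k$. *)
rewrite leqNgt; apply/negP => lt_km.
have := incr k lt_km; rewrite !coef_dom_poly cardT ltnS.
have [-> ->] : (0 < k <= n)%N /\ (k < n)%N by lia.
by rewrite ler_nat leqNgt decr //; lia.
Qed.
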